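(* Let $n\ge 1$ and let $f(s)=s^{n}+a_{n-1}s^{n-1}+\ldots+a_{1}s+a_{0}$ be a monic polynomial of degree $n$ with complex coefficients. Let $N_f=\{k\in\{0,\ldots,n-1\}: a_k\neq 0\}$. Then the following hold, where $p$ ranges over $\mathbb{Q}$: (a) if $N_f$ is non-empty and $k^{\ast}=\min\{k:k\in N_f\}$, then: if $|a_{k^{\ast}}|\le 1$, for every $p\le 0$ the power $f^{[p]}$ is not Schur stable; and if $|a_{k^{\ast}}|\ge 1$, for every $p\ge 0$ the power $f^{[p]}$ is not Schur stable; (b) if the set $N_{f,1+}=\{k\in N_f:|a_k|>1\}$ is non-empty, then for every $p\ge\beta_{\max}^{\ast}$ the power $f^{[p]}$ is not Schur stable, where $$\beta_{\max}^{\ast}=\min_{k\in N_{f,1+}}\frac{\ln\binom{n}{k}}{\ln|a_k|}\ \ge 0;$$ (c) if the set $N_{f,1-}=\{k\in N_f:|a_k|<1\}$ is non-empty, then for every $p\le\beta_{\min}^{\ast}$ the power $f^{[p]}$ is not Schur stable, where $$\beta_{\min}^{\ast}=\max_{k\in N_{f,1-}}\frac{\ln\binom{n}{k}}{\ln|a_k|}\ \le 0.$$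
   Context: A polynomial is Schur stable if all its zeros lie in the open unit disc $\{z\in\mathbb{C}:|z|<1\}$. For $p\in\mathbb{Q}$, the $p$-th Hadamard power of $f(s)=s^{n}+a_{n-1}s^{n-1}+\ldots+a_0$ is $f^{[p]}(s)=s^{n}+a_{n-1}^{p}s^{n-1}+\ldots+a_1^{p}s+a_{0}^{p}$, with the convention $0^p=0$ for every $p\in\mathbb{Q}$ (including $p\le 0$). If $p$ is an integer this is a single polynomial. If $p=k/m$ is a non-integer rational, with $k,m$ relatively prime integers and $m>0$, then for $a_j=|a_j|(\cos\alpha_j+i\sin\alpha_j)\neq 0$ the power $a_j^p$ is the set of the $m$ values $$a_{j,l}^{p}=|a_j|^{p}\big(\cos(p\alpha_j+2\pi l/m)+i\sin(p\alpha_j+2\pi l/m)\big),\quad l=0,\ldots,m-1,$$ i.e. the set of complex numbers whose $m$-th power is $a_j^k$. In that case $f^{[p]}$ is understood as the set of all polynomials $s^{n}+a_{n-1,l_{n-1}}^{p}s^{n-1}+\ldots+a_{1,l_1}^{p}s+a_{0,l_0}^{p}$ obtained by choosing the value of each coefficient independently (zero coefficients remain zero), and $f^{[p]}$ is called Schur stable if every polynomial in this set is Schur stable. *)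

(* Defs.v *)
From HB Require Import structures.
From mathcomp Require Import all_boot all_order all_algebra.
From mathcomp Require Import reals exp complex.

Set Implicit Arguments.
Unset Strict Implicit.
Unset Printing Implicit Defensive.

Import Order.TTheory GRing.Theory Num.Theory.

Local Open Scope ring_scope.
Local Open Scope complex_scope.

(* Modulus as an element of R; `|z| in R[i] lives in R[i]. *)
Definition cmod (R : realType) (z : R[i]) : R := complex.Re `|z|.

Definition schur_stable (R : realType) (g : {poly R[i]}) : Prop :=
  forall z : R[i], root g z -> cmod z < 1.

(* [rat_power p a b]: b is one of the values of a ^ p.  In lowest terms
   p = k / m with k = numq p and m = denq p > 0, these are the m-th roots of
   a ^ k; for p integer, m = 1 and a ^ p is the only value.  By convention
   0 ^ p = 0 for every p. *)
Definition rat_power (R : realType) (p : rat) (a b : R[i]) : Prop :=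
  if a == 0 then b = 0 else b ^ denq p = a ^ numq p.

(* [hadamard_power p f g]: g is a member of the p-th Hadamard power of the monic
   polynomial f.  The leading coefficient remains 1 (it is not replaced by other
   values of 1 ^ p), and the values of the other ones are chosen independently. *)
Definition hadamard_power (R : realType) (p : rat) (f g : {poly R[i]}) : Prop :=
  exists b : nat -> R[i],
    (forall k : nat, (k < (size f).-1)%N -> rat_power p f`_k (b k)) /\
    g = 'X^((size f).-1) + \sum_(k < (size f).-1) b k *: 'X^k.

Definition hadamard_schur_stable (R : realType) (p : rat) (f : {poly R[i]}) :
    Prop :=
  forall g : {poly R[i]}, hadamard_power p f g -> schur_stable g.

Section FiniteExtrema.
Context {d : Order.disp_t} {T : orderType d} {I : finType}.

(* Minimum and maximum of F over A, with junk value x0 when A is empty. *)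
Definition min_over (x0 : T) (A : {set I}) (F : I -> T) : T :=
  if [pick k in A] is Some k0 then F [arg min_(k < k0 in A) F k]%O else x0.

Definition max_over (x0 : T) (A : {set I}) (F : I -> T) : T :=
  if [pick k in A] is Some k0 then F [arg max_(k > k0 in A) F k]%O else x0.

End FiniteExtrema.

Section IndexSets.
Context {R : realType} (n : nat) (f : {poly R[i]}).

Definition Nf : {set 'I_n} := [set k : 'I_n | f`_k != 0].

Definition Nf1plus : {set 'I_n} := [set k in Nf | 1 < cmod f`_k].

Definition Nf1minus : {set 'I_n} := [set k in Nf | cmod f`_k < 1].

Definition kstar : nat := min_over 0%N Nf (fun k : 'I_n => k : nat).

Definition beta_max : R :=
  min_over 0 Nf1plus (fun k : 'I_n => ln ('C(n, k)%:R) / ln (cmod f`_k)).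

Definition beta_min : R :=
  max_over 0 Nf1minus (fun k : 'I_n => ln ('C(n, k)%:R) / ln (cmod f`_k)).

End IndexSets.

(* Main.v *)
Require Import Defs.
From HB Require Import structures.
From mathcomp Require Import all_boot all_order all_algebra.
From mathcomp Require Import reals exp complex.

Set Implicit Arguments.
Unset Strict Implicit.
Unset Printing Implicit Defensive.

Import Order.TTheory GRing.Theory Num.Theory.

Local Open Scope ring_scope.
Local Open Scope complex_scope.

(** Up to sign, the coefficient of degree [k] of a monic polynomial of degree
    [n] is the elementary symmetric function of degree [n - k] of its roots, a
    sum of ['C(n, k)] products of [n - k] roots.  If all roots lie in the open
    unit disc and [k < n], every such product has modulus [< 1], so the
    coefficient has modulus [< 'C(n, k)] ([norm_coef_prod_XsubC]).  If moreover
    all coefficients of lower degree vanish, then at least [k] roots are zero, so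
    at most one product, of the remaining ones, survives, and the bound is [1]
    ([norm_low_coef_prod_XsubC]).

    All values of [a ^ p] have the same modulus [|a| ^ p], so on a logarithmic
    scale Schur stability of a single member of the [p]-th Hadamard power of [f]
    already forces [p * ln |a_k| < ln 'C(n, k)] for every nonzero coefficient
    [a_k], and [p * ln |a_k| < 0] for the lowest one.  Such a member exists
    because complex numbers have roots of all orders
    ([hadamard_schur_stable_roots]).  The ranges of [p] in the theorem are
    exactly those where one of these inequalities fails: the definitions of
    [beta_max] and [beta_min] solve [p * ln |a_k| >= ln 'C(n, k)] for [p],
    according to the sign of [ln |a_k|]. *)

(** * Coefficients of a product of linear factors *)

Section CoefProdXsubC.
Context {D : numDomainType}.
Implicit Types (s : seq D) (z : D) (k : nat).

Lemma coef_prod_XsubC_cons z s k :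
  (\prod_(x <- z :: s) ('X - x%:P))`_k =
  (if k == 0%N then 0 else (\prod_(x <- s) ('X - x%:P))`_k.-1)
  - z * (\prod_(x <- s) ('X - x%:P))`_k.
Proof. by rewrite big_cons mulrBl coefB coefXM coefCM. Qed.

Lemma lead_coef_prod_XsubC s : (\prod_(x <- s) ('X - x%:P))`_(size s) = 1.
Proof.
have /monicP := monic_prod_XsubC s xpredT (@id D).
by rewrite lead_coefE size_prod_XsubC.
Qed.

(** A further factor ['X - z] turns the bounds for [n] into those for [n + 1] by Pascal's
    rule.  The weak bound for all [k], leading coefficient included, is what the
    term carrying the factor [z] needs; strictness comes from the other term,
    or, when [k = 0], from [`|z| < 1]. *)
Lemma norm_coef_prod_XsubC s k : (forall z, z \in s -> `|z| < 1) ->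
  `|(\prod_(x <- s) ('X - x%:P))`_k| <= 'C(size s, k)%:R
    ?= iff (size s <= k)%N.
Proof.
move=> s_lt1; apply/leifP; elim: s s_lt1 k => [|z s IHs] s_lt1 k.
  rewrite big_nil coefC leq0n bin0n.
  by case: k => [|k] /=; rewrite ?normr1 ?normr0.
have z_lt1 : `|z| < 1 by apply: s_lt1; rewrite mem_head.
have {}IHs j : `|(\prod_(x <- s) ('X - x%:P))`_j| < 'C(size s, j)%:R
    \/ (size s <= j)%N /\
       `|(\prod_(x <- s) ('X - x%:P))`_j| = 'C(size s, j)%:R.
  have /(_ j) := IHs (fun x xs => s_lt1 x (mem_behead (s := z :: s) xs)).
  by case: ifP => [_ /eqP|_]; [right | left].
have IHle j : `|(\prod_(x <- s) ('X - x%:P))`_j| <= 'C(size s, j)%:R.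
  by case: (IHs j) => [/ltW|[_ ->]].
have [n_le_k|k_lt_n] := leqP (size (z :: s)) k.
  move: n_le_k; rewrite leq_eqVlt => /orP[/eqP <-|n_lt_k].
    by rewrite lead_coef_prod_XsubC binn normr1.
  by rewrite nth_default ?size_prod_XsubC // bin_small // normr0.
rewrite coef_prod_XsubC_cons; case: k k_lt_n => [|k] /= k_lt_n.
  rewrite sub0r normrN normrM bin0.
  have := IHle 0%N; rewrite bin0 => ?.
  by apply: (le_lt_trans _ z_lt1); rewrite ler_piMr.
rewrite binS natrD [ltRHS]addrC.
apply: le_lt_trans (ler_normB _ _) _; apply: ltr_leD.
  by case: (IHs k) => // -[]; rewrite leqNgt -ltnS k_lt_n.
by rewrite normrM; apply: le_trans (IHle _); rewrite ler_piMl // ltW.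
Qed.

(** A zero root shifts the coefficients, while a nonzero root multiplies the
    lowest nonzero coefficient by its modulus. *)
Lemma norm_low_coef_prod_XsubC s k : (forall z, z \in s -> `|z| < 1) ->
    (forall j, (j < k)%N -> (\prod_(x <- s) ('X - x%:P))`_j = 0) ->
    (k < size s)%N ->
  `|(\prod_(x <- s) ('X - x%:P))`_k| < 1.
Proof.
elim: s k => [//|z s IHs] k s_lt1 low0.
have z_lt1 : `|z| < 1 by apply: s_lt1; rewrite mem_head.
have {}IHs j := IHs j (fun x xs => s_lt1 x (mem_behead (s := z :: s) xs)).
case: (eqVneq z 0) => [z0|z_neq0].
  rewrite coef_prod_XsubC_cons z0 mul0r subr0.
  case: k low0 => [|k] low0 /=; first by rewrite normr0 ltr01.
  rewrite ltnS; apply: IHs => j j_lt_k.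
  by have := low0 j.+1 j_lt_k; rewrite coef_prod_XsubC_cons z0 mul0r subr0.
have tail0 j : (j < k)%N -> (\prod_(x <- s) ('X - x%:P))`_j = 0.
  elim: j => [|j IHj] j_lt_k; have /eqP := low0 _ j_lt_k.
    rewrite coef_prod_XsubC_cons /= sub0r oppr_eq0 mulf_eq0 (negPf z_neq0).
    by move=> /eqP.
  rewrite coef_prod_XsubC_cons /= IHj ?(ltnW j_lt_k) // sub0r oppr_eq0.
  by rewrite mulf_eq0 (negPf z_neq0) => /eqP.
rewrite ltnS => k_le_n; rewrite coef_prod_XsubC_cons.
have -> : (if k == 0%N then 0 else (\prod_(x <- s) ('X - x%:P))`_k.-1) = 0.
  by case: k tail0 {low0 k_le_n} => //= k -> //.
rewrite sub0r normrN normrM; apply: (le_lt_trans _ z_lt1).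
rewrite ler_piMr //; move: k_le_n; rewrite leq_eqVlt => /orP[/eqP ->|k_lt_n].
  by rewrite lead_coef_prod_XsubC normr1.
exact/ltW/IHs.
Qed.

End CoefProdXsubC.

(** * Moduli of rational powers *)

Section RationalPower.
Context {R : realType}.
Implicit Types (a b z : R[i]) (p : rat).

Lemma normc_cmod z : `|z| = (cmod z)%:C.
Proof. by rewrite /cmod normc_def. Qed.

Lemma cmod_gt0 z : (0 < cmod z) = (z != 0).
Proof. by rewrite -ltcR -normc_cmod normr_gt0. Qed.

Lemma ln_cmod_exprz a (m : int) : a != 0 ->
  ln (cmod (a ^ m)) = m%:~R * ln (cmod a).
Proof.
move=> a_neq0.
have cmodX k : cmod (a ^+ k) = cmod a ^+ k.
  by apply: (@complexI R); rewrite rmorphXn /= -!normc_cmod normrX.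
have a_gt0 : 0 < cmod a by rewrite cmod_gt0.
case: m => k; first by rewrite -exprnP cmodX lnXn // mulr_natl.
rewrite NegzE -exprnN.
have -> : cmod (a ^- k.+1) = (cmod a ^+ k.+1)^-1.
  by apply: (@complexI R); rewrite fmorphV /= -cmodX -!normc_cmod normfV.
by rewrite lnV ?posrE ?exprn_gt0 // lnXn // mulrNz mulNr mulr_natl.
Qed.

Definition rat_root p a : R[i] :=
  if a == 0 then 0 else `|denq p|%N.-root (a ^ numq p).

Lemma rat_rootP p a : rat_power p a (rat_root p a).
Proof.
rewrite /rat_power /rat_root; case: eqP => // _.
by rewrite -absz_denq -exprnP absz_denq rootCK // absz_gt0 denq_neq0.
Qed.

Lemma rat_power_neq0 p a b : a != 0 -> rat_power p a b -> b != 0.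
Proof.
move=> a_neq0; rewrite /rat_power (negPf a_neq0) => b_pow.
apply: contraTneq (expfz_neq0 (numq p) a_neq0) => b0.
by rewrite -b_pow b0 exp0rz denq_eq0 eqxx.
Qed.

(** Taking moduli removes the ambiguity in the choice of the root. *)
Lemma ln_cmod_rat_power p a b : a != 0 -> rat_power p a b ->
  ln (cmod b) = ratr p * ln (cmod a).
Proof.
move=> a_neq0 b_pow; have b_neq0 := rat_power_neq0 a_neq0 b_pow.
move: b_pow; rewrite /rat_power (negPf a_neq0).
move=> /(congr1 (fun z => ln (cmod z))); rewrite !ln_cmod_exprz // => b_pow.
have d_neq0 : (denq p)%:~R != 0 :> R by rewrite intr_eq0 denq_eq0.
by apply: (mulfI d_neq0); rewrite b_pow mulrA /ratr mulrCA divff // mulr1.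
Qed.

End RationalPower.

(** * Constraints imposed by Schur stability *)

Section StableHadamardPower.
Context {R : realType} (n : nat) (f : {poly R[i]}) (p : rat).
Hypotheses (f_deg : size f = n.+1) (f_stable : hadamard_schur_stable p f).

(** One arbitrarily chosen member of the Hadamard power, split into linear
    factors. *)
Lemma hadamard_schur_stable_roots : exists s : seq R[i],
  [/\ size s = n, forall z, z \in s -> `|z| < 1
    & forall k, (k < n)%N ->
        rat_power p f`_k (\prod_(x <- s) ('X - x%:P))`_k].
Proof.
pose b k := rat_root p f`_k.
pose g := 'X^n + \sum_(k < n) b k *: 'X^k.
have low_size : (size (\poly_(k < n) b k)%R < n.+1)%N by rewrite ltnS size_poly.
have gE : g = 'X^n + \poly_(k < n) b k by rewrite /g poly_def.
have g_monic : g \is monic.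
  by rewrite monicE gE lead_coefDl ?size_polyXn ?lead_coefXn.
have g_size : size g = n.+1 by rewrite gE size_polyDl size_polyXn.
have g_stable : schur_stable g.
  apply: f_stable; exists b; rewrite f_deg; split=> // k _; exact: rat_rootP.
have [s g_prod] := closed_field_poly_normal g.
move: g_prod; rewrite (monicP g_monic) scale1r => g_prod.
exists s; split=> [|z z_s|k k_lt_n].
- by apply: succn_inj; rewrite -g_size g_prod size_prod_XsubC.
- rewrite normc_cmod (ltcR (cmod z) 1); apply: g_stable.
  by rewrite g_prod root_prod_XsubC.
- rewrite -g_prod gE coefD coefXn coef_poly k_lt_n (ltn_eqF k_lt_n) add0r.
  exact: rat_rootP.
Qed.

Lemma ln_coef_lt_ln_binomial (k : nat) : (k < n)%N -> f`_k != 0 ->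
  ratr p * ln (cmod f`_k) < ln 'C(n, k)%:R.
Proof.
move=> k_lt_n fk_neq0.
have [s [s_size s_lt1 /(_ k k_lt_n) b_pow]] := hadamard_schur_stable_roots.
have b_neq0 := rat_power_neq0 fk_neq0 b_pow.
rewrite -(ln_cmod_rat_power fk_neq0 b_pow).
rewrite ltr_ln ?posrE ?cmod_gt0 ?ltr0n ?bin_gt0 1?ltnW //.
have := lt_leif (norm_coef_prod_XsubC k s_lt1).
by rewrite s_size -ltnNge k_lt_n normc_cmod -(rmorph_nat (real_complex R)) ltcR.
Qed.

Lemma ln_low_coef_lt0 (k : nat) : (k < n)%N -> f`_k != 0 ->
    (forall j, (j < k)%N -> f`_j = 0) ->
  ratr p * ln (cmod f`_k) < 0.
Proof.
move=> k_lt_n fk_neq0 low0.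
have [s [s_size s_lt1 b_pow]] := hadamard_schur_stable_roots.
have bk_pow := b_pow k k_lt_n; have bk_neq0 := rat_power_neq0 fk_neq0 bk_pow.
rewrite -(ln_cmod_rat_power fk_neq0 bk_pow) ln_lt0 // cmod_gt0 bk_neq0 /=.
rewrite -(ltcR _ 1) -normc_cmod; apply: norm_low_coef_prod_XsubC => //.
  move=> j j_lt_k; have := b_pow j (ltn_trans j_lt_k k_lt_n).
  by rewrite /rat_power low0 // eqxx.
by rewrite s_size.
Qed.

End StableHadamardPower.

(** * Extrema over finite sets *)

Section Extrema.
Context {d : Order.disp_t} {T : orderType d} {I : finType}.
Implicit Types (A : {set I}) (F : I -> T).

Lemma min_over_attained x0 A F : A != set0 ->
  exists2 k, k \in A &
    min_over x0 A F = F k /\ forall j, j \in A -> (F k <= F j)%O.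
Proof.
case/set0Pn => i iA; rewrite /min_over; case: pickP => [k0 k0A|/(_ i)].
  by case: arg_minP => // k kA k_min; exists k.
by rewrite /= iA.
Qed.

Lemma max_over_attained x0 A F : A != set0 ->
  exists2 k, k \in A & max_over x0 A F = F k.
Proof.
case/set0Pn => i iA; rewrite /max_over; case: pickP => [k0 k0A|/(_ i)].
  by case: arg_maxP => // k kA _; exists k.
by rewrite /= iA.
Qed.

End Extrema.

Lemma kstarP (R : realType) (n : nat) (f : {poly R[i]}) : Nf n f != set0 ->
  [/\ (kstar n f < n)%N, f`_(kstar n f) != 0
    & forall j, (j < kstar n f)%N -> f`_j = 0].
Proof.
move=> /(min_over_attained 0%N (fun k : 'I_n => k : nat)).
rewrite -/(kstar n f) => -[k]; rewrite inE => fk_neq0 [-> k_min].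
split=> // j j_lt_k; apply/eqP; apply: contraLR j_lt_k => fj_neq0.
rewrite -leqNgt; have [n_le_j|j_lt_n] := leqP n j.
  exact: leq_trans (ltnW (ltn_ord k)) n_le_j.
by apply: (k_min (Ordinal j_lt_n)); rewrite inE.
Qed.

Theorem theorem2 (R : realType) (n : nat) (hn : (1 <= n)%N) (f : {poly R[i]})
    (f_monic : f \is monic) (f_deg : size f = n.+1) :
  (Nf n f != set0 ->
     (cmod f`_(kstar n f) <= 1 ->
        forall p : rat, p <= 0 -> ~ hadamard_schur_stable p f) /\
     (1 <= cmod f`_(kstar n f) ->
        forall p : rat, 0 <= p -> ~ hadamard_schur_stable p f)) /\
  (Nf1plus n f != set0 ->
     0 <= beta_max n f /\
     forall p : rat, beta_max n f <= ratr p -> ~ hadamard_schur_stable p f) /\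
  (Nf1minus n f != set0 ->
     beta_min n f <= 0 /\
     forall p : rat, ratr p <= beta_min n f -> ~ hadamard_schur_stable p f).
Proof.
have ln_bin_ge0 (k : 'I_n) : 0 <= ln ('C(n, k)%:R) :> R.
  by rewrite ln_ge0 // ler1n bin_gt0 ltnW.
split; [|split].
- move=> /kstarP[k_lt_n fk_neq0 low0].
  split=> fk1 p p_sign /(ln_low_coef_lt0 f_deg) /(_ _ k_lt_n fk_neq0 low0);
    apply/negP; rewrite -leNgt.
  + by rewrite mulr_le0 ?lerq0 ?ln_le0.
  + by rewrite mulr_ge0 ?ler0q ?ln_ge0.
- move=> /(min_over_attained (0 : R)
    (fun k : 'I_n => ln ('C(n, k)%:R) / ln (cmod f`_k))).
  rewrite -/(beta_max n f) => -[k + [-> _]]; rewrite !inE => /andP[fk_neq0 fk1].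
  have lnf_gt0 := ln_gt0 fk1.
  split=> [|p p_ge]; first by rewrite divr_ge0 // ltW.
  move=> /(ln_coef_lt_ln_binomial f_deg) /(_ _ (ltn_ord k) fk_neq0).
  by apply/negP; rewrite -leNgt -ler_pdivrMr.
- move=> /(max_over_attained (0 : R)
    (fun k : 'I_n => ln ('C(n, k)%:R) / ln (cmod f`_k))).
  rewrite -/(beta_min n f) => -[k + ->]; rewrite !inE => /andP[fk_neq0 fk1].
  have lnf_lt0 : ln (cmod f`_k) < 0 by rewrite ln_lt0 // cmod_gt0 fk_neq0.
  split=> [|p p_le].
    by rewrite mulr_ge0_le0 // invr_le0 ltW.
  move=> /(ln_coef_lt_ln_binomial f_deg) /(_ _ (ltn_ord k) fk_neq0).
  by apply/negP; rewrite -leNgt -ler_ndivlMr.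
Qed.
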